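(* For every $k\ge2$ there is a graph $G$ with $\mathrm{ctdw}(G)\le5$ and $\mathrm{rtdw}(G)\ge k$.
   Context: A strong tree decomposition of $G=(V,E)$ is $(\{X_i\}_{i\in I},T=(I,F))$ where $\{X_i\}$ partitions $V$ and $T$ is a tree such that each edge has both ends in one bag or in bags of two adjacent tree nodes; its width is the maximum bag size. A tree distance decomposition is a strong tree decomposition with root $r$ such that each $v\in X_i$, $i\neq r$, has a neighbor in the bag of the parent of $i$. $\mathrm{ctdw}(G)$ (root-connected tree distance width) is the minimum width of a tree distance decomposition whose root bag induces a connected subgraph; $\mathrm{rtdw}(G)$ (rooted tree distance width) is the minimum width of a tree distance decomposition whose root bag consists of a single vertex. *)

(* Defs.v *)
From HB Require Import structures.
From mathcomp Require Import all_boot.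

Set Implicit Arguments.
Unset Strict Implicit.
Unset Printing Implicit Defensive.

Record sgraph := SGraph {
  vertex :> finType;
  adj : rel vertex;
  adj_sym : symmetric adj;
  adj_irr : irreflexive adj }.

Definition connected_in (G : sgraph) (A : {set G}) : Prop :=
  A != set0 /\ {in A &, forall x y, connect [rel u v in A | adj u v] x y}.

Definition is_tree (T : sgraph) : Prop :=
  connected_in [set: T] /\
  (forall c : seq T, 2 < size c -> ~ ucycle (@adj T) c).

(* In a tree, the parent of [i] with respect to the root [r] is the second
   vertex of the simple path from [i] to [r]; the root itself has none. *)
Definition is_parent (T : sgraph) (r i j : T) : Prop :=
  exists p : seq T,
    [/\ path (@adj T) i (j :: p), uniq (i :: j :: p) & last j p = r].

(* The set of bags forgets the indexing, so injectivity of [bag] is needed to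
   say that distinct nodes carry distinct, hence disjoint, blocks. *)
Record strong_tree_dec (G : sgraph) := StrongTreeDec {
  dec_tree : sgraph;
  bag : dec_tree -> {set G};
  dec_tree_is_tree : is_tree dec_tree;
  bag_inj : injective bag;
  bag_partition : partition [set bag i | i : dec_tree] [set: G];
  bag_edge : forall (u v : G) (i j : dec_tree),
    adj u v -> u \in bag i -> v \in bag j -> i = j \/ adj i j }.

Definition width (G : sgraph) (D : strong_tree_dec G) : nat :=
  \max_(i : dec_tree D) #|bag i|.

Definition tree_distance_dec
    (G : sgraph) (D : strong_tree_dec G) (r : dec_tree D) : Prop :=
  forall (i : dec_tree D) (v : G), i != r -> v \in bag i ->
  exists j : dec_tree D,
    is_parent r i j /\ exists2 u : G, u \in bag j & adj v u.

Definition is_minimum (P : nat -> Prop) (w : nat) : Prop :=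
  P w /\ forall w' : nat, P w' -> w <= w'.

(* Both widths are minima that exist only when the graph is connected and
   nonempty, so they are given as relations between a graph and a number. *)
Definition is_ctdw (G : sgraph) : nat -> Prop :=
  is_minimum (fun w => exists (D : strong_tree_dec G) (r : dec_tree D),
    [/\ tree_distance_dec r, connected_in (bag r) & width D = w]).

Definition is_rtdw (G : sgraph) : nat -> Prop :=
  is_minimum (fun w => exists (D : strong_tree_dec G) (r : dec_tree D),
    [/\ tree_distance_dec r, #|bag r| = 1 & width D = w]).

(* Main.v *)
Require Import Defs.
From HB Require Import structures.
From mathcomp Require Import all_boot.
From Stdlib Require Import Classical_Prop.

Set Implicit Arguments.
Unset Strict Implicit.
Unset Printing Implicit Defensive.

(** The book graph with [n > k] pages, i.e. the product of an edge and a star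
    with [n] leaves, separates the two widths. Grouping the vertices by their star
    coordinate gives a tree distance decomposition of width 2 whose root is the
    spine edge. In a tree distance decomposition rooted at a single vertex [v],
    the depth of the bag of [x] is the distance from [v] to [x], and two vertices
    with a common neighbor one level deeper lie in the same bag, because a node
    has only one parent. If [v] lies on side [s], this puts the leaves of side
    [s] on all the pages avoiding [v] into the bag of the opposite hub. *)

(** * Simple paths, depth and parents in a rooted tree *)

Section Trees.

Variable T : sgraph.
Hypothesis T_acyclic : forall c : seq T, 2 < size c -> ~ ucycle (@adj T) c.

Lemma acyclic_path_unique (x : T) (p q : seq T) :
  path (@adj T) x p -> path (@adj T) x q -> uniq (x :: p) -> uniq (x :: q) ->
  last x p = last x q -> p = q.
Proof.
elim: p x q => [|y p IHp] x [|z q] //.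
- by move=> _ _ _ /= /andP[xq _] xE; rewrite xE mem_last in xq.
- by move=> _ _ /= /andP[xp _] _ xE; rewrite -xE mem_last in xp.
case: (eqVneq y z) => [<-|yz] xp xq Up Uq lpq.
  move: xp xq Up Uq => /= /andP[_ yp] /andP[_ yq] /andP[_ Up] /andP[_ Uq].
  by congr (_ :: _); apply: (IHp y).
(* Follow [p] up to its first vertex [w] on [q], then return to [x] along [q]:
   this is a cycle. *)
exfalso.
have: has (mem (z :: q)) (y :: p).
  apply/hasP; exists (last y p); first exact: mem_last.
  by rewrite /= in lpq; rewrite lpq; apply: mem_last.
move Ep: (y :: p) xp Up => p0 xp Up hasw.
case/split_find: hasw Ep xp Up => w p1 p2.
move Eq: (z :: q) xq Uq => q0 xq Uq wq.
have {}wq : w \in q0 by exact: wq.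
case/path.splitP: wq Eq xq Uq => q1 q2 Eq xq Uq disj Ep xp Up.
apply: (T_acyclic (c := x :: rcons p1 w ++ rev q1)).
  (* If [p1] and [q1] were both empty, [y] and [z] would both equal [w]; so the cycle has at least
     three vertices. *)
  rewrite /= size_cat size_rcons size_rev.
  by case: p1 q1 Ep Eq {disj xp Up xq Uq} => [|? ?] [|? ?] //= [yE _] [zE _];
    rewrite yE zE eqxx in yz.
apply/andP; split.
  rewrite /= rcons_cat cat_path last_rcons.
  move: xp xq; rewrite !cat_path => /andP[-> _] /andP[xq _] /=.
  have := rev_path (@adj T) x (rcons q1 w).
  rewrite last_rcons belast_rcons rev_cons => ->.
  by rewrite (eq_path (e' := @adj T)) // => a b; apply: adj_sym.
move: Up Uq; rewrite -!cat_cons !cat_uniq => /andP[Up _] /andP[Uq _].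
rewrite Up rev_uniq /=.
move: Uq; rewrite /= rcons_uniq mem_rcons inE negb_or.
case/and3P=> /andP[xw xq1] wq1 ->; rewrite andbT.
apply/hasPn => u; rewrite mem_rev => uq1 /=.
rewrite inE mem_rcons inE !negb_or; apply/and3P; split.
- by apply: contraNneq xq1 => <-.
- by apply: contraNneq wq1 => <-.
apply: contra disj => up1; apply/hasP; exists u => //=.
by rewrite mem_cat mem_rcons inE uq1 orbT.
Qed.

Variable r : T.
Hypothesis T_connected : forall x y : T, connect (@adj T) x y.

Definition root_path (i : T) : pred (seq T) :=
  [pred p | [&& path (@adj T) i p, uniq (i :: p) & last i p == r]].

Lemma root_path_exists (i : T) : exists p, root_path i p.
Proof.
have /connectP[p ip rE] := T_connected i r.
case/shortenP: ip rE => p' ip' Up' _ rE.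
by exists p'; rewrite /root_path /= ip' -rE eqxx; move: Up' => /= ->.
Qed.

Definition depth (i : T) : nat := size (xchoose (root_path_exists i)).

Lemma depthE (i : T) (p : seq T) : root_path i p -> depth i = size p.
Proof.
rewrite /depth; move: (xchooseP (root_path_exists i)).
case/and3P=> ip Up /eqP lp /and3P[iq Uq /eqP lq].
by congr size; apply: (@acyclic_path_unique i) => //; rewrite lp lq.
Qed.

Lemma depth_root : depth r = 0.
Proof. by rewrite (@depthE r [::]) //= /root_path /= eqxx. Qed.

Lemma depth_parent (i j : T) : is_parent r i j -> depth i = (depth j).+1.
Proof.
case=> p [/= /andP[ij jp] /andP[inp Up] lp].
rewrite (@depthE i (j :: p)) ?(@depthE j p) // /root_path /=.
  by rewrite jp lp eqxx Up.
by rewrite ij jp lp eqxx inp Up.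
Qed.

Lemma parent_unique (i j j' : T) : is_parent r i j -> is_parent r i j' -> j = j'.
Proof.
case=> p [ip Up lp] [p' [ip' Up' lp']].
by have [] : j :: p = j' :: p'
  by apply: (@acyclic_path_unique i) => //=; rewrite lp lp'.
Qed.

(** Take a simple path from [i] to the root. If it meets [j], the edge to [j] followed by the rest
    of the path after [j] makes [j] the parent; otherwise prefixing [j] to it makes [i] the
    parent. *)
Lemma adj_parent (i j : T) : adj i j -> is_parent r i j \/ is_parent r j i.
Proof.
move=> ij; have [p /and3P[ip Up /eqP lp]] := root_path_exists i.
have [jp|jp] := boolP (j \in p).
  left; case/splitPr: jp ip Up lp => p1 p2.
  rewrite cat_path last_cat -cat_cons cat_uniq => /andP[_ /= /andP[_ jp2]].
  case/and3P=> _ dis /andP[jp2' Up2] lp; exists p2; split => //=.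
    by rewrite ij.
  move: dis; rewrite negb_or => /andP[_ /hasPn dis].
  rewrite /= inE negb_or jp2' Up2 !andbT; apply/andP; split.
    by apply: contraTneq ij => ->; rewrite adj_irr.
  by apply/negP => /dis /=; rewrite inE eqxx.
right; exists p; split=> //; first by rewrite /= adj_sym ij.
rewrite cons_uniq Up andbT inE negb_or jp andbT.
by apply: contraTneq ij => ->; rewrite adj_irr.
Qed.

End Trees.

(** * Distance functions and the levels of a decomposition *)

Definition is_distance_from (G : sgraph) (v : G) (g : G -> nat) : Prop :=
  [/\ g v = 0,
      forall u w : G, adj u w -> g u <= (g w).+1
    & forall u : G, u != v -> exists2 w, adj u w & g u = (g w).+1].

(** Descending along [h] reaches [v] in [h u] steps, and [g] changes by at most one per step, so [g]
    is at most [h]; the roles are symmetric. *)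
Lemma is_distance_from_unique (G : sgraph) (v : G) (g h : G -> nat) :
  is_distance_from v g -> is_distance_from v h -> g =1 h.
Proof.
have le (g1 g2 : G -> nat) : is_distance_from v g1 -> is_distance_from v g2 ->
    forall n u, g2 u <= n -> g1 u <= g2 u.
  case=> g1v lip _ [_ _ step]; elim=> [|n IHn] u.
    case: (eqVneq u v) => [->|uv]; first by rewrite g1v.
    by have [w _ ->] := step u uv.
  case: (eqVneq u v) => [->|uv]; first by rewrite g1v.
  have [w uw ->] := step u uv; rewrite ltnS => /IHn gw.
  exact: leq_trans (lip _ _ uw) _.
move=> dg dh u; apply/eqP; rewrite eqn_leq.
by rewrite (le _ _ dg dh (h u)) // (le _ _ dh dg (g u)).
Qed.

Lemma mem_bag_exists (G : sgraph) (D : strong_tree_dec G) (x : G) :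
  exists i, x \in bag (s := D) i.
Proof.
have := bag_partition D => /and3P[/eqP cov _ _].
have : x \in cover [set bag (s := D) i | i : dec_tree D] by rewrite cov inE.
by case/bigcupP=> B /imsetP[i _ ->] xi; exists i.
Qed.

Lemma mem_bag_unique (G : sgraph) (D : strong_tree_dec G) (x : G)
    (i j : dec_tree D) : x \in bag i -> x \in bag j -> i = j.
Proof.
move=> xi xj; apply: (@bag_inj _ D).
have := bag_partition D => /and3P[_ triv _].
by rewrite -(def_pblock triv _ xi) ?(def_pblock triv _ xj) ?imset_f.
Qed.

Lemma common_lower_neighbor_same_bag (G : sgraph) (D : strong_tree_dec G)
    (r : dec_tree D) (v : G) (g : G -> nat) :
  tree_distance_dec r -> bag r = [set v] -> is_distance_from v g ->
  forall u w x (i : dec_tree D), adj x u -> adj x w ->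
  g x = (g u).+1 -> g x = (g w).+1 -> u \in bag i -> w \in bag i.
Proof.
move=> tdd rv dg.
have [[_ con] acyc] := dec_tree_is_tree D.
have conn (a b : dec_tree D) : connect (@adj (dec_tree D)) a b.
  have := con a b (in_setT _) (in_setT _); apply: connect_sub => c d.
  by case/andP=> _; apply: connect1.
pose node x := xchoose (mem_bag_exists D x).
have nodeP x : x \in bag (node x) := xchooseP (mem_bag_exists D x).
have nodeE x i : x \in bag i -> node x = i
  by move=> xi; apply: mem_bag_unique (nodeP x) xi.
pose dep x := depth r conn (node x).
have dep_dist : is_distance_from v dep.
  split.
  - by rewrite /dep (nodeE v r) ?rv ?set11 ?(depth_root acyc).
  - move=> a b ab; rewrite /dep.
    case: (bag_edge ab (nodeP a) (nodeP b)) => [->|nab]; first exact: leqnSn.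
    case: (adj_parent r conn nab) => /(depth_parent acyc conn) ->;
      by rewrite // !leqW.
  - move=> a av; have rna : node a != r.
      by apply: contra av => /eqP ar; rewrite -in_set1 -rv -ar.
    have [j [par [b bj ab]]] := tdd _ _ rna (nodeP a).
    exists b => //; rewrite /dep (nodeE b j bj).
    exact: (depth_parent acyc conn par).
have gE := is_distance_from_unique dg dep_dist.
(* An edge along which the distance drops neither stays in its bag nor descends to a child, so it
   leads to the parent. *)
have par x u : adj x u -> g x = (g u).+1 -> is_parent r (node x) (node u).
  move=> xu; rewrite !gE /dep => dxu.
  case: (bag_edge xu (nodeP x) (nodeP u)) => [E|nxu].
    by rewrite E in dxu; case: (n_Sn _ dxu).
  case: (adj_parent r conn nxu) => // /(depth_parent acyc conn) E.
  by have /eqP := dxu; rewrite E ltn_eqF // ltnS leqnSn.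
move=> u w x i xu xw gxu gxw ui.
rewrite -(nodeE u i ui).
by rewrite (parent_unique acyc (par _ _ xu gxu) (par _ _ xw gxw)).
Qed.

(** * Decompositions into the fibers of a map onto a tree *)

Section DecOfMap.

Variables (G T : sgraph) (f : G -> T).
Hypothesis T_tree : is_tree T.
Hypothesis f_surj : forall i, exists x, f x = i.
Hypothesis f_adj : forall u v, adj u v -> f u = f v \/ adj (f u) (f v).

Let fiber (i : T) : {set G} := [set x | f x == i].

Lemma fiber_inj : injective fiber.
Proof.
move=> i j ij; have [x xi] := f_surj i.
have : x \in fiber i by rewrite inE xi.
by rewrite ij inE xi => /eqP.
Qed.

Lemma fiber_partition : partition [set fiber i | i : T] [set: G].
Proof.
apply/and3P; split.
- apply/eqP/setP => x; rewrite inE; apply/bigcupP.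
  by exists (fiber (f x)); [apply: imset_f | rewrite inE].
- apply/trivIsetP => _ _ /imsetP[i _ ->] /imsetP[j _ ->] ij.
  rewrite -setI_eq0; apply/eqP/setP => x; rewrite !inE.
  apply/negP => /andP[/eqP xi /eqP xj].
  by rewrite -xi xj eqxx in ij.
- apply/imsetP => -[i _ E]; have [x xi] := f_surj i.
  by have := in_set0 x; rewrite E inE xi eqxx.
Qed.

Lemma fiber_edge (u v : G) (i j : T) :
  adj u v -> u \in fiber i -> v \in fiber j -> i = j \/ adj i j.
Proof. by rewrite !inE => uv /eqP<- /eqP<-; apply: f_adj. Qed.

Definition dec_of_map : strong_tree_dec G :=
  StrongTreeDec T_tree fiber_inj fiber_partition fiber_edge.

End DecOfMap.

(** * Stars *)

Section Star.

Variable I : finType.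

(** [None] is the center and each [Some i] a leaf. *)
Definition star_adj (a b : option I) : bool := isSome a (+) isSome b.

Lemma star_adj_sym : symmetric star_adj.
Proof. by move=> a b; exact: addbC. Qed.

Lemma star_adj_irr : irreflexive star_adj.
Proof. by move=> a; exact: addbb. Qed.

Definition star : sgraph := SGraph star_adj_sym star_adj_irr.

Lemma star_is_tree : is_tree star.
Proof.
split.
  split; first by apply/set0Pn; exists None; rewrite inE.
  move=> x y _ _.
  have cN (z : star) : connect [rel u v in [set: star] | adj u v] None z.
    by case: z => [i|]; [apply: connect1; rewrite /= !inE | apply: connect0].
  apply: connect_trans (cN y); rewrite sym_connect_sym // => a b.
  by rewrite /= !inE star_adj_sym.
(* Walks alternate between center and leaves: a triangle fails by parity, and among four consecutive
   vertices [None] would repeat. *)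
move=> [|x [|y [|z c]]] //= _ /andP[].
by case: x y z c => [i|] [j|] [l|] [|[m|] c] //=; rewrite ?andbF ?inE ?eqxx ?orbT.
Qed.

End Star.

(** * The book graph and its decompositions *)

Section Book.

Variable n : nat.

(** The Boolean is the side, and [None] marks the hub of each side. *)
Definition book_adj (u v : bool * option 'I_n) : bool :=
  if u.1 == v.1 then star_adj u.2 v.2 else u.2 == v.2.

Lemma book_adj_sym : symmetric book_adj.
Proof.
by move=> u v; rewrite /book_adj eq_sym [u.2 == _]eq_sym star_adj_sym.
Qed.

Lemma book_adj_irr : irreflexive book_adj.
Proof. by move=> u; rewrite /book_adj eqxx star_adj_irr. Qed.

Definition book : sgraph := SGraph book_adj_sym book_adj_irr.

Definition star_dist (a b : option 'I_n) : nat :=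
  if a == b then 0 else if isSome a && isSome b then 2 else 1.

(** Distances add up in a Cartesian product: a step towards [v] first changes the side if needed,
    then moves in the star. *)
Lemma book_distance (v : book) :
  is_distance_from v (fun u : book => (u.1 != v.1) + star_dist u.2 v.2).
Proof.
case: v => s a; split; first by rewrite /= /star_dist !eqxx.
  move=> [t b] [t' c]; rewrite /= /book_adj /star_adj /star_dist /=.
  case: (eqVneq t t') => [->|tt']; last first.
    move/eqP->; rewrite -addSn leq_add2r.
    by case: (t != s); case: (t' != s).
  rewrite -addnS leq_add2l.
  case: b c a => [i|] [j|] [l|] //= _;
    by do ?case: ifP.
move=> [t b]; rewrite xpair_eqE negb_and /=.
case: (eqVneq t s) => [->|ts _] /=; last first.
  exists (s, b); first by rewrite /= /book_adj /= (negPf ts).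
  by rewrite eqxx.
rewrite /star_dist; case: b a => [i|] [j|] //= ij.
- exists (s, None); rewrite /= ?/book_adj /= eqxx //=.
  by rewrite eqE /= in ij; rewrite eqE /= (negPf ij).
- by exists (s, None); rewrite /= ?/book_adj /= ?eqxx.
- by exists (s, Some j); rewrite /= ?/book_adj /= ?eqxx.
Qed.

Lemma book_rooted_width (D : strong_tree_dec book) (r : dec_tree D) :
  tree_distance_dec r -> #|bag r| = 1 -> n.-1 <= width D.
Proof.
move=> tdd /eqP/cards1P[[s a] ra].
have [i hub] := mem_bag_exists D (~~ s, None).
have sub : [set (s, Some j) | j in [set j | Some j != a]] \subset bag i.
  apply/subsetP => y /imsetP[j]; rewrite inE => ja ->.
  (* The leaf [(~~ s, Some j)] has both its hub and [(s, Some j)] as neighbors one step closer to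
     the root vertex. *)
  apply: (common_lower_neighbor_same_bag tdd ra (book_distance (s, a))
    (u := (~~ s, None)) (x := (~~ s, Some j))) hub;
    rewrite /= ?/book_adj /star_dist /= ?(negPf ja) ?eqxx //;
    by case: s a ja {ra} => [] [?|].
apply: leq_trans (leq_bigmax i); apply: leq_trans (subset_leq_card sub).
rewrite card_imset; last by move=> ? ? [].
(* A root vertex on page [l] excludes that page; a hub excludes none. *)
rewrite -[n in n.-1]card_ord; case: a {ra sub} => [l|].
  rewrite -(cardC1 l); apply: subset_leq_card.
  by apply/subsetP => j; rewrite !inE eqE.
by rewrite (_ : [set _ | _] = setT) ?cardsT ?leq_pred //; apply/setP => j; rewrite !inE.
Qed.

Lemma book_ctdw_dec :
  exists (D : strong_tree_dec book) (r : dec_tree D),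
    [/\ tree_distance_dec r, connected_in (bag r) & width D <= 2].
Proof.
have surj (i : star 'I_n) : exists x : book, x.2 = i by exists (true, i).
have fadj (u v : book) : adj u v ->
    u.2 = v.2 \/ adj (u.2 : star 'I_n) v.2.
  by rewrite /= /book_adj; case: ifP => _ => [|/eqP]; [right | left].
exists (dec_of_map (@star_is_tree 'I_n) surj fadj), None; split.
- case=> // i [s a] _; rewrite inE => /eqP /= ->.
  exists None; split; first by exists [::].
  by exists (s, None); rewrite ?inE /= ?/book_adj /= ?eqxx.
- split; first by apply/set0Pn; exists (true, None); rewrite inE.
  move=> [s a] [t b]; rewrite !inE => /eqP /= -> /eqP /= ->.
  case: (eqVneq s t) => [->|st]; first exact: connect0.
  by apply: connect1; rewrite /= !inE /book_adj /= (negPf st).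
- apply/bigmax_leqP => i _.
  apply: (@leq_trans #|[set (true, i); (false, i)]|); last by rewrite cards2.
  apply: subset_leq_card; apply/subsetP => -[s a]; rewrite !inE => /eqP /= ->.
  by case: s; rewrite eqxx ?orbT.
Qed.

(* The tree is a star rooted at a leaf: its root is the hub [(true, None)], its
   center consists of the neighbors of that hub. *)
Lemma book_rtdw_dec :
  exists (D : strong_tree_dec book) (r : dec_tree D),
    tree_distance_dec r /\ #|bag r| = 1.
Proof.
(* The test picks one class of the bipartition of the book as the center bag; every vertex of the
   other class gets its own leaf. *)
pose f (x : book) : star (option 'I_n) :=
  if x.1 == isSome x.2 then None else Some x.2.
have surj i : exists x : book, f x = i.
  case: i => [a|]; first by exists (~~ isSome a, a); rewrite /f /=; case: a.
  by exists (false, None).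
have fadj (u v : book) : adj u v -> f u = f v \/ adj (f u) (f v).
  case: u v => [s a] [t b] /= uv; right; move: uv; rewrite /f /=.
  by case: s t a b => [] [] [i|] [j|].
exists (dec_of_map (@star_is_tree _) surj fadj), (Some None); split; last first.
  apply/eqP/cards1P; exists (true, None).
  by apply/setP => -[[] [i|]]; rewrite !inE.
case=> [[i|]|] // [s a] _; rewrite inE /f => /eqP /=.
  case: s a => [] [j|] // [ij]; subst j.
  exists None; split; first by exists [:: Some None].
  by exists (false, None); rewrite ?inE.
move=> va; exists (Some None); split; first by exists [::].
exists (true, None); first by rewrite inE.
by case: s a va => [] [j|].
Qed.

End Book.

(** * Existence of the minima and the conclusion *)

(** Classical least number principle: without a minimum, strong induction refutes every [P w]. *)
Lemma is_minimum_exists (P : nat -> Prop) :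
  (exists w, P w) -> exists w, is_minimum P w.
Proof.
case=> w Pw; apply: NNPP => nmin; elim/ltn_ind: w Pw => w IHw Pw.
apply: nmin; exists w; split=> // w' Pw'.
by rewrite leqNgt; apply/negP => /IHw /(_ Pw').
Qed.

Theorem theorem5 (k : nat) (hk : 2 <= k) :
  exists (G : sgraph) (c r : nat),
    [/\ is_ctdw G c, is_rtdw G r, c <= 5 & k <= r].
Proof.
(* One page more than [k], since [book_rooted_width] loses one. *)
have [D [i [tdd con wD]]] := book_ctdw_dec k.+1.
have [D' [i' [tdd' card1]]] := book_rtdw_dec k.+1.
have [c ctdw] : exists c, is_ctdw (book k.+1) c.
  by apply: is_minimum_exists; exists (width D), D, i.
(* Here [D'] only ensures that the minimum exists. *)
have [r rtdw] : exists r, is_rtdw (book k.+1) r.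
  by apply: is_minimum_exists; exists (width D'), D', i'.
exists (book k.+1), c, r; split=> //.
  have cD : c <= width D by apply: ctdw.2; exists D, i.
  exact: leq_trans cD (leq_trans wD _).
have [[E [j [tddE cardE <-]]] _] := rtdw.
exact: book_rooted_width tddE cardE.
Qed.
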